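(* Let $\varepsilon>0$, $c>0$, $\delta\ge 0$, $\gamma\in(0,1)$ and $T\ge e^{\varepsilon}$ be real numbers. Let $\mathcal{A}$ be an oracle algorithm (which only outputs tuples it received from its oracle calls) satisfying the following properties for all $D$, $n$, $R$ and every $\varepsilon$-DP mechanism $\mathcal{M}: D^n\to R\times\mathbb{R}$: (Privacy) $\mathcal{A}^{\mathcal{M}}$ is $(c\varepsilon,\delta)$-DP. (Utility) For every input $d\in D^n$, $\Pr[\mathrm{val}(\mathcal{A}^{\mathcal{M}}(d))\ge \mathrm{Median}(\mathrm{val}(\mathcal{M}(d)))]\ge 1-\gamma$. (Runtime) For every input $d \in D^n$, $\mathcal{A}^{\mathcal M}$ on input $d$ makes at most $T$ calls to $\mathcal{M}$ in expectation, where the calls may be on any inputs in $D^n$ (not necessarily $d$). Then, if $\varepsilon\le 3$ and $\delta<\frac{\varepsilon\gamma}{40\ln(8T)}$, we have $T\ge \frac{1}{8}(8\gamma)^{-\frac{1}{40c}}$, or equivalently, $c\ge \frac{\ln\frac{1}{8\gamma}}{40\ln(8T)}$.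
   Context: For a set $D$ and integer $n\ge1$, a dataset is an element of $D^n$; the Hamming distance $|d-d'|_H$ is the number of entries in which $d,d'$ differ, and $d,d'$ are neighboring if $|d-d'|_H=1$. A randomized algorithm (mechanism) $\mathcal{M}$ on $D^n$ is $(\varepsilon,\delta)$-differentially private (DP) if for all neighboring $d,d'$ and all (measurable) sets $S$ of outputs, $\Pr[\mathcal{M}(d)\in S]\le e^{\varepsilon}\Pr[\mathcal{M}(d')\in S]+\delta$; $\varepsilon$-DP means $(\varepsilon,0)$-DP. Mechanisms here output a tuple $(o,v)\in R\times\mathbb{R}$, where $R$ is an arbitrary output space and $v$ is a quality score; $\mathrm{val}((o,v))=v$. $\mathrm{Median}(\mathrm{val}(\mathcal{M}(d)))=\sup\{z:\Pr_{(o,v)\sim\mathcal{M}(d)}[v\ge z]\ge \tfrac12\}$. An oracle algorithm $\mathcal{A}$ takes a dataset $d\in D^n$ and has black-box oracle access to a mechanism $\mathcal{M}$: it may adaptively call $\mathcal{M}$ on inputs, each call returning a fresh independent sample of $\mathcal{M}$'s output on that input. Standing assumption: the output of $\mathcal{A}^{\mathcal{M}}$ is always one of the tuples $(o,v)$ returned by one of its calls to $\mathcal{M}$. Probabilities and expectations are over the randomness of both $\mathcal{A}$ and $\mathcal{M}$. *)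

(* Defs.v *)
From HB Require Import structures.
From mathcomp Require Import all_boot all_order all_algebra.
From mathcomp Require Import all_classical all_reals all_analysis.

Set Implicit Arguments.
Unset Strict Implicit.
Unset Printing Implicit Defensive.

Import Order.TTheory GRing.Theory Num.Theory.
Import numFieldNormedType.Exports.

Local Open Scope classical_set_scope.
Local Open Scope ring_scope.
Local Open Scope ereal_scope.

Definition hamming (T : eqType) (n : nat) (x y : n.-tuple T) : nat :=
  #|[pred i : 'I_n | tnth x i != tnth y i]|.

(* [P x S] is the probability that the output on dataset [x] lies in [S]; it is
   a bare set function so that the definition applies both to a mechanism
   (a kernel) and to an algorithm run against one. *)
Definition dp (R : realType) (T : eqType) (n : nat)
    (dY : measure_display) (Y : measurableType dY) (eps delta : R)
    (P : n.-tuple T -> set Y -> \bar R) : Prop :=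
  forall x x' : n.-tuple T, hamming x x' = 1%N ->
  forall S : set Y, measurable S ->
    P x S <= (expR eps)%:E * P x' S + delta%:E.

Section mechanism.
Context (R : realType) (dD : measure_display) (D : measurableType dD) (n : nat).
Context (dO : measure_display) (O : measurableType dO).

Local Notation scored := (O * measurableTypeR R)%type.

(* Datasets carry the product sigma-algebra and the output law depends
   measurably on the dataset, as is needed for querying at a random dataset.
   Over a countable discrete D this allows every family of probability laws. *)
Definition mechanism : Type := R.-pker (n.-tuple D) ~> scored.

Definition median_val (mu : set scored -> \bar R) : R :=
  sup [set z : R | (2^-1)%:E <= mu [set y | (z <= y.2)%R]].

(* An adaptive algorithm is a measurable deterministic strategy reading random
   coins drawn once at the start (its random tape).  [act x (w, h)] is the next
   action on input dataset [x] with coins [w] after [k] calls, whose answers are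
   listed in [h], latest first: [inl q] calls the mechanism on [q]; [inr i]
   halts and returns the answer [tnth h i].  Past queries are not recorded
   because they are functions of [x], [w] and [h].  As 'I_0 is empty, at least
   one call is made. *)
Record oracle_algorithm : Type := OracleAlgorithm {
  coins_display : measure_display ;
  coins : measurableType coins_display ;
  coins_law : probability coins R ;
  act : n.-tuple D ->
    forall k : nat, coins * k.-tuple scored -> n.-tuple D + 'I_k ;
  measurable_act_call : forall x k (B : set (n.-tuple D)), measurable B ->
    measurable [set wh | exists2 q, B q & act x (k := k) wh = inl q] ;
  measurable_act_halt : forall x k (i : 'I_k),
    measurable [set wh | act x wh = inr i]
}.

Section run.
Context (A : oracle_algorithm) (M : mechanism) (x : n.-tuple D).

(* Probability, given coins [w] and past answers [h], of halting within [m]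
   further calls with output in [S]; each call draws a fresh answer. *)
Fixpoint halt_prob (S : set scored) (m : nat) (w : coins A)
    (k : nat) (h : k.-tuple scored) {struct m} : \bar R :=
  match act x (w, h) with
  | inr i => \d_(tnth h i) S
  | inl q =>
      if m is m'.+1 then
        \int[M q]_y halt_prob S m' w (cons_tuple y h)
      else 0
  end.

(* Expectation, given [w] and [h], of min(N, m) for N the number of further
   calls. *)
Fixpoint calls_upto (m : nat) (w : coins A)
    (k : nat) (h : k.-tuple scored) {struct m} : \bar R :=
  match act x (w, h) with
  | inr _ => 0
  | inl q =>
      if m is m'.+1 then
        1 + \int[M q]_y calls_upto m' w (cons_tuple y h)
      else 0
  end.

(* The suprema below are limits of nondecreasing sequences: the event of halting
   with output in S is the increasing union over m of halting within m calls,
   and E[min(N, m)] increases to E[N], also when N may be infinite. *)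
Definition output_prob (S : set scored) : \bar R :=
  ereal_sup (range (fun m : nat =>
    \int[coins_law A]_w halt_prob S m w [tuple])).

Definition expected_calls : \bar R :=
  ereal_sup (range (fun m : nat =>
    \int[coins_law A]_w calls_upto m w [tuple])).

End run.
End mechanism.

(* Main.v *)
Require Import Defs.
From mathcomp Require Import all_boot all_order all_algebra.
From mathcomp Require Import all_classical all_reals all_analysis.
From mathcomp Require Import measurable_realfun.
From HB Require Import structures.
From mathcomp Require Import ring lra.

Set Implicit Arguments.
Unset Strict Implicit.
Unset Printing Implicit Defensive.

Import Order.TTheory GRing.Theory Num.Theory.
Import numFieldNormedType.Exports.

Local Open Scope classical_set_scope.
Local Open Scope ring_scope.

(** Hide a secret value [s] among [N] candidates: the mechanism returns score 1
    with probability [p(q) = e^(eps (k - n)) / 2], where [k] counts the entries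
    of the dataset [q] equal to [s], and score 0 otherwise.  It is [eps]-DP, and
    at [(s, ..., s)] its median score is 1, so there the algorithm returns score
    0 with probability at most [gamma].  Started at [(0, ..., 0)], the algorithm
    sees a coin of bias [p0 = e^(- eps n) / 2] until it queries a dataset
    containing [s]; as one dataset contains at most [n] candidates, for some [s]
    it returns score 1 with probability at most [(n / N + p0) T].  With
    [n ~ ln (4 T) / eps] and [N] large this is at most [1 / 4], so it returns
    score 0 with probability at least [3 / 4 - gamma].  Group privacy along the
    [n] steps from [(0, ..., 0)] to [(s, ..., s)] bounds that probability by
    [e^(c eps n) (gamma + n delta)], which forces [c] to be large. *)

(** * Two-point mechanisms *)

Record bias (R : realType) (d : measure_display) (X : measurableType d) := Bias {
  bias_fun :> X -> R ;
  bias_measurable : measurable_fun setT bias_fun ;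
  bias_ge0 : forall x, 0 <= bias_fun x ;
  bias_le1 : forall x, bias_fun x <= 1 }.

Section two_point.
Context (R : realType) (dX : measure_display) (X : measurableType dX).
Context (dY : measure_display) (Y : measurableType dY).
Variables (b : bias R X) (y1 y0 : Y).

Lemma onem_bias_ge0 x : 0 <= 1 - b x.
Proof. by rewrite subr_ge0 bias_le1. Qed.

Definition two_point (x : X) : {measure set Y -> \bar R} :=
  measure_add (mscale (NngNum (bias_ge0 b x)) (dirac y1))
              (mscale (NngNum (onem_bias_ge0 x)) (dirac y0)).

Lemma two_pointE x S :
  two_point x S = (b x * \1_S y1 + (1 - b x) * \1_S y0)%:E.
Proof. by rewrite [LHS]measure_addE. Qed.

Let measurable_two_point U : measurable U ->
  measurable_fun [set: X] (two_point ^~ U).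
Proof.
move=> mU; rewrite (_ : (two_point ^~ U) =
    (fun x => (b x * \1_U y1 + (1 - b x) * \1_U y0)%:E)); last first.
  by apply/funext => x; rewrite two_pointE.
apply/measurable_EFinP/measurable_funD; apply: measurable_funM => //.
  exact: bias_measurable.
by apply: measurable_funB => //; exact: bias_measurable.
Qed.

HB.instance Definition _ := isKernel.Build _ _ _ _ _ two_point
  measurable_two_point.

Let two_point_setT x : two_point x [set: Y] = 1%E.
Proof. by rewrite two_pointE !indicT !mulr1 addrC subrK. Qed.

HB.instance Definition _ := Kernel_isProbability.Build _ _ _ _ _
  two_point two_point_setT.

(** Turns each integral over an answer into a two-term average, so that truncated runs become a
    recursion over the reals. *)
Lemma integral_two_point x (f : Y -> R) : (forall y, 0 <= f y) ->
  measurable_fun setT f ->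
  (\int[two_point x]_y (f y)%:E = (b x * f y1 + (1 - b x) * f y0)%:E)%E.
Proof.
move=> f0 mf; have mfE : measurable_fun setT (EFin \o f) by exact/measurable_EFinP.
have fE0 y : [set: Y] y -> (0 <= (f y)%:E)%E by rewrite lee_fin.
rewrite /two_point ge0_integral_measure_add// !ge0_integral_mscale//.
by rewrite !integral_dirac// !diracT !mul1e.
Qed.

End two_point.

(** * Runs against a two-point mechanism *)

Section payoff.
Context (R : realType) (dD : measure_display) (D : measurableType dD) (n : nat).
Context (dO : measure_display) (O : measurableType dO).
Local Notation scored := (O * measurableTypeR R)%type.
Variables (A : oracle_algorithm R D n O) (x : n.-tuple D).
Variables (b : bias R (n.-tuple D)) (y1 y0 : scored).

Section defs.
Variables (g : forall k, k.-tuple scored -> 'I_k -> R) (r : R).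

(* Expected payoff of a run truncated after [m] calls: [g] is earned on halting,
   [r] on each call.  [halt_prob] and [calls_upto] are both instances of it. *)
Fixpoint payoff (m : nat) (w : coins A) (k : nat) (h : k.-tuple scored) : R :=
  match act x (w, h) with
  | inr i => g h i
  | inl q =>
      if m is m'.+1 then
        r + b q * payoff m' w (cons_tuple y1 h)
          + (1 - b q) * payoff m' w (cons_tuple y0 h)
      else 0
  end.

Lemma payoffS m w k (h : k.-tuple scored) : payoff m.+1 w h =
  match act x (w, h) with
  | inr i => g h i
  | inl q => r + b q * payoff m w (cons_tuple y1 h)
               + (1 - b q) * payoff m w (cons_tuple y0 h)
  end.
Proof. by []. Qed.

(** [act] is controlled only through the events of calling on a query in a measurable set and of
    halting at a given index, so the case analysis is rewritten with indicators of these events. *)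
Lemma measurable_act_case k (F : R) (F1 F0 : coins A * k.-tuple scored -> R)
    (G : 'I_k -> coins A * k.-tuple scored -> R) :
  measurable_fun setT F1 -> measurable_fun setT F0 ->
  (forall i, measurable_fun setT (G i)) ->
  measurable_fun setT (fun wh => match act x wh with
    | inl q => F + b q * F1 wh + (1 - b q) * F0 wh
    | inr i => G i wh end).
Proof.
move=> mF1 mF0 mG.
pose called (B : set (n.-tuple D)) :=
  [set wh | exists2 q, B q & act (o := A) x (k := k) wh = inl q].
have mcalled B : measurable B -> measurable (called B).
  exact: measurable_act_call.
pose halted i := [set wh | act (o := A) x (k := k) wh = inr i].
have mhalted i : measurable (halted i) by exact: measurable_act_halt.
pose bq wh := match act (o := A) x (k := k) wh with inl q => b q | inr _ => 0 end.
have mbq : measurable_fun setT bq.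
  move=> _ U mU; rewrite setTI.
  (* The second set accounts for halting, where [bq] takes the default value 0. *)
  have -> : bq @^-1` U = called (b @^-1` U) `|` (~` called setT `&` [set _ | U 0]).
    apply/seteqP; split => wh; rewrite /called /bq /=.
      case E : (act x wh) => [q|i] Uq; first by left; exists q.
      by right; split => // -[].
    case=> [[q Uq ->//]|[]].
    by case E : (act x wh) => [q|i] // + _; case; exists q.
  apply: measurableU.
    apply: mcalled; rewrite -[X in measurable X]setTI.
    exact: bias_measurable.
  apply: measurableI; first by apply: measurableC; exact: mcalled.
  have [U0|nU0] := pselect (U 0).
    by rewrite (_ : [set _ | _] = setT)//; apply/seteqP; split.
  by rewrite (_ : [set _ | _] = set0)//; apply/seteqP; split.
rewrite (_ : (fun wh => _) = (fun wh =>
   \1_(called setT) wh * (F + bq wh * F1 wh + (1 - bq wh) * F0 wh) +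
   \sum_(i < k) \1_(halted i) wh * G i wh)); last first.
  apply/funext => wh; rewrite /bq.
  case E : (act x wh) => [q|i].
    rewrite big1 => [|i _]; first by rewrite indicE mem_set ?mul1r ?addr0//; exists q.
    by rewrite indicE memNset ?mul0r// /halted /= E.
  rewrite (bigD1 i)//= big1 => [|j ji].
    have -> : \1_(called setT) wh = 0 :> R.
      by rewrite indicE memNset// => -[q _]; rewrite E; discriminate.
    by rewrite mul0r add0r addr0 indicE mem_set ?mul1r.
  rewrite indicE memNset ?mul0r// /halted /= E => -[] ij.
  by rewrite ij eqxx in ji.
apply: measurable_funD.
  apply: measurable_funM; first by apply: measurable_indic; apply: mcalled.
  apply: measurable_funD; first apply: measurable_funD => //.
    exact: measurable_funM.
  by apply: measurable_funM => //; apply: measurable_funB.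
by apply: measurable_sum => i; apply: measurable_funM => //; exact: measurable_indic.
Qed.

Hypothesis mg : forall k (i : 'I_k),
  measurable_fun setT (fun h : k.-tuple scored => g h i).

(** Coins and history are treated jointly because the induction lengthens the history; the sections
    of this function then serve the integrals over the coins and over an answer. *)
Lemma measurable_payoff m k :
  measurable_fun setT (fun wh : coins A * k.-tuple scored => payoff m wh.1 wh.2).
Proof.
elim: m k => [|m IH] k /=.
  (* With no calls left a query pays 0, written as a query with zero continuations to fit
     [measurable_act_case]. *)
  rewrite (_ : (fun wh => _) = (fun wh => match act (o := A) x (k := k) wh with
    | inl q => 0 + b q * cst 0 wh + (1 - b q) * cst 0 wh
    | inr i => g wh.2 i end)); last first.
    by apply/funext => -[w h] /=; case: (act _ _) => // q; rewrite /cst !mulr0 !addr0.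
  apply: measurable_act_case => // i.
  exact: (measurableT_comp (mg i)).
rewrite (_ : (fun wh => _) = (fun wh => match act (o := A) x (k := k) wh with
    | inl q => r + b q * payoff m wh.1 (cons_tuple y1 wh.2)
                 + (1 - b q) * payoff m wh.1 (cons_tuple y0 wh.2)
    | inr i => g wh.2 i end)); last by apply/funext => -[w h].
apply: measurable_act_case; last by move=> i; exact: (measurableT_comp (mg i)).
- apply: (measurableT_comp (IH k.+1)
    (g := fun wh : coins A * k.-tuple scored => (wh.1, cons_tuple y1 wh.2))).
  by apply: measurable_fun_pair => //; apply: measurable_cons.
- apply: (measurableT_comp (IH k.+1)
    (g := fun wh : coins A * k.-tuple scored => (wh.1, cons_tuple y0 wh.2))).
  by apply: measurable_fun_pair => //; apply: measurable_cons.
Qed.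

Lemma measurable_payoff_coins m k (h : k.-tuple scored) :
  measurable_fun setT (fun w => payoff m w h).
Proof.
rewrite (_ : (fun w => _) =
  (fun wh : coins A * k.-tuple scored => payoff m wh.1 wh.2) \o (pair ^~ h))//.
apply: measurableT_comp; first exact: measurable_payoff.
exact: measurable_fun_pair.
Qed.

Lemma measurable_payoff_answer m w k (h : k.-tuple scored) :
  measurable_fun setT (fun y => payoff m w (cons_tuple y h)).
Proof.
rewrite (_ : (fun y => _) =
  (fun wh : coins A * k.+1.-tuple scored => payoff m wh.1 wh.2) \o
  (fun y => (w, cons_tuple y h)))//.
apply: measurableT_comp; first exact: measurable_payoff.
by apply: measurable_fun_pair => //; apply: measurable_cons.
Qed.

Hypothesis g_ge0 : forall k (h : k.-tuple scored) i, 0 <= g h i.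
Hypothesis r_ge0 : 0 <= r.

Lemma payoff_ge0 m w k (h : k.-tuple scored) : 0 <= payoff m w h.
Proof.
elim: m k h => [|m IH] k h /=; case: (act _ _) => // q.
by rewrite !addr_ge0 ?mulr_ge0 ?bias_ge0 ?onem_bias_ge0.
Qed.

Lemma payoff_nondecreasing m w k (h : k.-tuple scored) :
  payoff m w h <= payoff m.+1 w h.
Proof.
elim: m k h => [|m IH] k h.
  rewrite payoffS [leLHS]/=; case: (act _ _) => // q.
  by rewrite !addr_ge0 ?mulr_ge0 ?bias_ge0 ?onem_bias_ge0 ?payoff_ge0.
rewrite (payoffS m) (payoffS m.+1); case: (act _ _) => // q.
by rewrite !lerD// ler_wpM2l ?bias_ge0 ?onem_bias_ge0.
Qed.

End defs.

Let M : mechanism R D n O := two_point b y1 y0.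

Definition halt_gain (S : set scored) k (h : k.-tuple scored) (i : 'I_k) : R :=
  \1_S (tnth h i).

Lemma measurable_halt_gain S : measurable S -> forall k (i : 'I_k),
  measurable_fun setT (fun h : k.-tuple scored => halt_gain S h i).
Proof.
move=> mS k i.
rewrite (_ : (fun h => _) = (\1_S : _ -> R) \o (fun h => tnth h i))//.
by apply: measurableT_comp; [exact: measurable_indic|exact: measurable_tnth].
Qed.

Lemma halt_gain_ge0 S k (h : k.-tuple scored) i : 0 <= halt_gain S h i.
Proof. by rewrite /halt_gain indicE. Qed.

Lemma halt_probE S m w k (h : k.-tuple scored) : measurable S ->
  halt_prob M x S m w h = (payoff (halt_gain S) 0 m w h)%:E.
Proof.
move=> mS; elim: m k h => [|m IH] k h /=.
  by case: (act _ _) => // i; rewrite diracE /halt_gain indicE.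
case: (act _ _) => [q|i]; last by rewrite diracE /halt_gain indicE.
under eq_integral do rewrite IH.
rewrite integral_two_point ?add0r//.
  by move=> y; exact/payoff_ge0/lexx/halt_gain_ge0.
by apply: measurable_payoff_answer; exact: measurable_halt_gain.
Qed.

Definition no_gain k (h : k.-tuple scored) (i : 'I_k) : R := 0.

Lemma calls_uptoE m w k (h : k.-tuple scored) :
  calls_upto M x m w h = (payoff no_gain 1 m w h)%:E.
Proof.
elim: m k h => [|m IH] k h /=; first by case: (act _ _).
case: (act _ _) => [q|i] //.
under eq_integral do rewrite IH.
rewrite integral_two_point -?EFinD ?addrA//.
  by move=> y; exact: payoff_ge0.
by apply: measurable_payoff_answer => *; exact: measurable_cst.
Qed.

End payoff.

(** Induction step of [sum_hits_le]: [a] counts the candidates in the query, and the term [N],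
    incurred only after the answer of probability [p], joins [n] in the price [n + N * p] of the
    current call. *)
Lemma mix_le (R : realFieldType) (N n p a S1 S0 C1 C0 : R) :
  0 <= p -> p <= 1 -> a <= n -> S1 <= N + (n + N * p) * C1 ->
  S0 <= (n + N * p) * C0 ->
  a + p * S1 + (1 - p) * S0 <= (n + N * p) * (1 + p * C1 + (1 - p) * C0).
Proof.
move=> p0 p1 an S1le S0le.
have q0 : 0 <= 1 - p by rewrite subr_ge0.
have := ler_wpM2l p0 S1le; have := ler_wpM2l q0 S0le; nra.
Qed.

(** * Averaging over the secret *)

Section output.
Context (R : realType) (dD : measure_display) (D : measurableType dD) (n : nat).
Context (dO : measure_display) (O : measurableType dO).
Local Notation scored := (O * measurableTypeR R)%type.
Variables (A : oracle_algorithm R D n O) (x : n.-tuple D) (y1 y0 : scored).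

Local Notation hits b S := (payoff x b y1 y0 (halt_gain (R := R) S) 0).

Lemma hits_ge0 (b : bias R (n.-tuple D)) S m (w : coins A) k (h : k.-tuple scored) :
  0 <= hits b S m w h.
Proof. by apply: payoff_ge0 => // *; exact: halt_gain_ge0. Qed.

(** The missing mass is that of the runs still going after [m] calls. *)
Lemma hits_setC_le1 (b : bias R (n.-tuple D)) S m (w : coins A) k
    (h : k.-tuple scored) : hits b S m w h + hits b (~` S) m w h <= 1.
Proof.
elim: m k h => [|m IH] k h /=; case: (act _ _) => [q|i].
- by rewrite addr0.
- by rewrite /halt_gain !indicE in_setC; case: (_ \in _); rewrite /= ?addr0 ?add0r.
- have := IH _ (cons_tuple y1 h); have := IH _ (cons_tuple y0 h).
  have := bias_ge0 b q; have := bias_le1 b q; nra.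
- by rewrite /halt_gain !indicE in_setC; case: (_ \in _); rewrite /= ?addr0 ?add0r.
Qed.

Lemma hits_le1 (b : bias R (n.-tuple D)) S m (w : coins A) k (h : k.-tuple scored) :
  hits b S m w h <= 1.
Proof.
by apply: le_trans (hits_setC_le1 b S m w h); rewrite lerDl hits_ge0.
Qed.

(** The right-hand side is the probability of having halted within [m] calls, whatever the
    output. *)
Lemma hits_le_setC (b : bias R (n.-tuple D)) S U m (w : coins A) k
    (h : k.-tuple scored) :
  hits b U m w h <= hits b S m w h + hits b (~` S) m w h.
Proof.
elim: m k h => [|m IH] k h /=; case: (act _ _) => [q|i].
- by rewrite addr0.
- rewrite /halt_gain !indicE in_setC.
  by case: (_ \in U); case: (_ \in S); rewrite /= ?addr0 ?add0r.
- have := IH _ (cons_tuple y1 h); have := IH _ (cons_tuple y0 h).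
  have := bias_ge0 b q; have := bias_le1 b q; nra.
- rewrite /halt_gain !indicE in_setC.
  by case: (_ \in U); case: (_ \in S); rewrite /= ?addr0 ?add0r.
Qed.

(** * Output probabilities as limits of truncated runs *)

Section one_mechanism.
Variable b : bias R (n.-tuple D).

Let M : mechanism R D n O := two_point b y1 y0.

Lemma measurable_hits S m : measurable S ->
  measurable_fun setT (fun w : coins A => (hits b S m w [tuple])%:E).
Proof.
move=> mS; apply/measurable_EFinP; apply: measurable_payoff_coins.
exact: measurable_halt_gain.
Qed.

Lemma output_probE S : measurable S -> output_prob A M x S = ereal_sup (range
  (fun m => \int[coins_law A]_w (hits b S m w [tuple])%:E)%E).
Proof.
move=> mS; congr ereal_sup; apply: eq_imagel => m _.
by apply: eq_integral => w _; exact: halt_probE.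
Qed.

(** Longer truncations only add halted runs, so the supremum is a limit, and limits can be summed
    over events or over secrets. *)
Lemma cvg_output_prob S : measurable S ->
  (fun m => \int[coins_law A]_w (hits b S m w [tuple])%:E)%E @ \oo
    --> output_prob A M x S.
Proof.
move=> mS; rewrite output_probE//; apply: ereal_nondecreasing_cvgn.
apply/nondecreasing_seqP => m; apply: ge0_le_integral => //.
- by move=> w _; rewrite lee_fin hits_ge0.
- exact: measurable_hits.
- exact: measurable_hits.
- by move=> w _; rewrite lee_fin; exact: payoff_nondecreasing.
Qed.

Lemma integral_hits_ge0 S m :
  (0 <= \int[coins_law A]_w (hits b S m w [tuple])%:E)%E.
Proof. by apply: integral_ge0 => w _; rewrite lee_fin hits_ge0. Qed.

Lemma output_prob_ge0 S : measurable S -> (0 <= output_prob A M x S)%E.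
Proof.
move=> mS; rewrite output_probE//; apply: le_trans (integral_hits_ge0 S 0) _.
by apply: ereal_sup_ubound; exists 0%N.
Qed.

Lemma integral_hits_le_output_prob S m : measurable S ->
  (\int[coins_law A]_w (hits b S m w [tuple])%:E <= output_prob A M x S)%E.
Proof.
by move=> mS; rewrite output_probE//; apply: ereal_sup_ubound; exists m.
Qed.

Lemma integral_hits_setC S m : measurable S ->
  (\int[coins_law A]_w (hits b S m w [tuple])%:E +
   \int[coins_law A]_w (hits b (~` S) m w [tuple])%:E =
   \int[coins_law A]_w (hits b S m w [tuple] + hits b (~` S) m w [tuple])%:E)%E.
Proof.
move=> mS; rewrite -ge0_integralD//.
- by move=> w _; rewrite lee_fin hits_ge0.
- exact: measurable_hits.
- by move=> w _; rewrite lee_fin hits_ge0.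
- by apply: measurable_hits; exact: measurableC.
Qed.

Lemma measurable_hits_setC S m : measurable S -> measurable_fun setT
  (fun w : coins A => (hits b S m w [tuple] + hits b (~` S) m w [tuple])%:E).
Proof.
move=> mS; apply/measurable_EFinP/measurable_funD; apply/measurable_EFinP.
  exact: measurable_hits.
by apply: measurable_hits; exact: measurableC.
Qed.

Lemma output_prob_setC_le1 S : measurable S ->
  (output_prob A M x S + output_prob A M x (~` S) <= 1)%E.
Proof.
move=> mS; have mSC := measurableC mS.
have := cvgeD (ge0_adde_def _ _) (cvg_output_prob mS) (cvg_output_prob mSC).
rewrite !inE => /(_ _ (output_prob_ge0 mS) (output_prob_ge0 mSC)) cvgSC.
rewrite -(cvg_lim _ cvgSC)//; apply: lime_le; first by apply/cvg_ex; eexists; exact: cvgSC.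
apply: nearW => m; rewrite integral_hits_setC//.
apply: (@le_trans _ _ (\int[coins_law A]_w (cst 1 w))%E).
  apply: ge0_le_integral => //.
  - by move=> w _; rewrite lee_fin addr_ge0 ?hits_ge0.
  - exact: measurable_hits_setC.
  - by move=> w _; rewrite lee_fin hits_setC_le1.
by rewrite integral_cst// mul1e probability_le1.
Qed.

Lemma output_prob_le_setC S U : measurable S -> measurable U ->
  (output_prob A M x U <= output_prob A M x S + output_prob A M x (~` S))%E.
Proof.
move=> mS mU; have mSC := measurableC mS.
rewrite [leLHS]output_probE//; apply: ge_ereal_sup => _ [m _ <-].
apply: (@le_trans _ _ (\int[coins_law A]_w (hits b S m w [tuple])%:E +
   \int[coins_law A]_w (hits b (~` S) m w [tuple])%:E)%E); last first.
  by apply: leeD; exact: integral_hits_le_output_prob.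
rewrite integral_hits_setC//; apply: ge0_le_integral => //.
- by move=> w _; rewrite lee_fin hits_ge0.
- exact: measurable_hits.
- exact: measurable_hits_setC.
- by move=> w _; rewrite lee_fin hits_le_setC.
Qed.

Lemma output_prob_fin_num S : measurable S -> output_prob A M x S \is a fin_num.
Proof.
move=> mS; rewrite ge0_fin_numE ?output_prob_ge0//.
apply: (@le_lt_trans _ _ 1%E); last exact: ltry.
apply: le_trans (output_prob_setC_le1 mS).
by rewrite leeDl// output_prob_ge0//; exact: measurableC.
Qed.

End one_mechanism.

(** * Comparing all hidden coins with one constant coin *)

Section hidden_secret.
Variables (N : nat) (secret : 'I_N -> D) (b : 'I_N -> bias R (n.-tuple D)).
Variables (b0 : bias R (n.-tuple D)) (p0 : R) (good : set scored).
Hypothesis secret_inj : injective secret.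
Hypothesis b0E : forall q, b0 q = p0.
Hypothesis bE : forall i (q : n.-tuple D), secret i \notin q -> b i q = p0.
Hypothesis mgood : measurable good.
Hypothesis y0_bad : ~ good y0.

Let calls := payoff (A := A) x b0 y1 y0 (@no_gain R _ O) 1.

Lemma card_secrets_in (q : n.-tuple D) : (\sum_(i < N) (secret i \in q) <= n)%N.
Proof.
rewrite -big_mkcond sum1_card cardE -[leqRHS](size_tuple q).
rewrite -(size_map secret); apply: uniq_leq_size.
  by rewrite map_inj_uniq// enum_uniq.
by move=> _ /mapP[i + ->]; rewrite mem_enum.
Qed.

(* A query made while no score is good either contains [secret i], which happens
   for at most [n] indices [i], or meets a coin of bias [p0] that does not depend
   on [i]: each call thus costs at most [n + N p0]. *)
Lemma sum_hits_le m (w : coins A) k (h : k.-tuple scored) :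
  \sum_(i < N) hits (b i) good m w h <=
    N%:R * (has (mem good) h)%:R + (n%:R + N%:R * p0) * calls m w h.
Proof.
have p0_ge0 (q : n.-tuple D) : 0 <= p0 by rewrite -(b0E q) bias_ge0.
have p0_le1 (q : n.-tuple D) : p0 <= 1 by rewrite -(b0E q) bias_le1.
have calls_ge0 m' k' (h' : k'.-tuple scored) : 0 <= calls m' w h'.
  exact: payoff_ge0.
have sum_hits_leN m' k' (h' : k'.-tuple scored) :
    \sum_(i < N) hits (b i) good m' w h' <= N%:R.
  apply: (@le_trans _ _ (\sum_(i < N) 1)); last by rewrite sumr_const card_ord.
  by apply: ler_sum => i _; exact: hits_le1.
have coef_ge0 (q : n.-tuple D) : 0 <= n%:R + N%:R * p0.
  by rewrite addr_ge0 ?mulr_ge0 ?(p0_ge0 q).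
(* The output is an answer from the history, so halting can only succeed once a good answer has been
   seen. *)
have halted k' (h' : k'.-tuple scored) i :
    \sum_(j < N) halt_gain good h' i <= N%:R * (has (mem good) h')%:R.
  rewrite sumr_const card_ord -[leLHS]mulr_natl ler_wpM2l// /halt_gain indicE ler_nat.
  case: (boolP (tnth h' i \in good)) => // tgood.
  by rewrite (_ : has _ _ = true)//; apply/hasP; exists (tnth h' i); rewrite ?mem_tnth.
elim: m k h => [|m IH] k h; rewrite /calls /=; case E : (act _ _) => [q|i].
- by rewrite big1 ?mulr0 ?addr0// mulr_ge0.
- by rewrite mulr0 addr0.
- rewrite -/calls b0E.
  have p0_0 := p0_ge0 q; have p0_1 := p0_le1 q; have K0 := coef_ge0 q.
  have C1 := calls_ge0 m _ (cons_tuple y1 h).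
  have C0 := calls_ge0 m _ (cons_tuple y0 h).
  (* Once a good answer has been seen, the term [N] alone covers all candidates. *)
  case: (boolP (has _ h)) => [_|hbad].
    rewrite mulr1; apply: (@le_trans _ _ N%:R).
      have := sum_hits_leN m.+1 _ h; rewrite /= E; exact.
    by rewrite lerDl mulr_ge0// !addr_ge0// mulr_ge0// subr_ge0.
  have IH1 : \sum_(i < N) hits (b i) good m w (cons_tuple y1 h) <=
      N%:R + (n%:R + N%:R * p0) * calls m w (cons_tuple y1 h).
    apply: le_trans (IH _ _) _; rewrite lerD2r -[leRHS]mulr1 ler_wpM2l//.
    by case: (has _ _).
  have IH0 : \sum_(i < N) hits (b i) good m w (cons_tuple y0 h) <=
      (n%:R + N%:R * p0) * calls m w (cons_tuple y0 h).
    apply: le_trans (IH _ _) _; rewrite /= (negbTE hbad) orbF.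
    rewrite (_ : _ \in _ = false) ?mulr0 ?add0r//.
    by apply/negbTE/negP; rewrite inE.
  have queried : \sum_(i < N) ((secret i \in q)%:R : R) <= n%:R.
    by rewrite -natr_sum ler_nat card_secrets_in.
  (* A candidate occurring in [q] is given up with the trivial bound 1; all others meet the same
     coin [p0]. *)
  apply: (@le_trans _ _ (\sum_(i < N) ((secret i \in q)%:R +
      p0 * hits (b i) good m w (cons_tuple y1 h) +
      (1 - p0) * hits (b i) good m w (cons_tuple y0 h)))).
    apply: ler_sum => i _; case: (boolP (secret i \in q)) => [_|iq].
      have := hits_le1 (b i) good m.+1 w h; rewrite /= E => /le_trans; apply.
      by rewrite -addrA lerDl addr_ge0// mulr_ge0 ?subr_ge0// hits_ge0.
    by rewrite bE// add0r.
  rewrite !big_split/= -!mulr_sumr mulr0 add0r.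
  exact: mix_le.
- by rewrite mulr0 addr0.
Qed.

(** Integrates [sum_hits_le] over the coins from the empty history and lets the truncation grow; the
    number of calls is measured against the constant coin [b0] alone. *)
Lemma sum_output_prob_le (T : R) :
  (expected_calls A (two_point b0 y1 y0 : mechanism R D n O) x <= T%:E)%E ->
  (\sum_(i < N) output_prob A (two_point (b i) y1 y0 : mechanism R D n O) x good
    <= ((n%:R + N%:R * p0) * T)%:E)%E.
Proof.
move=> callsT.
have p0_ge0 : 0 <= p0 by rewrite -(b0E x) bias_ge0.
have K0 : 0 <= n%:R + N%:R * p0 by rewrite addr_ge0 ?mulr_ge0.
have mhits i m := @measurable_hits (b i) good m mgood.
have cvg_sum : (\sum_(i < N) \int[coins_law A]_w (hits (b i) good m w [tuple])%:E
    @[m --> \oo] --> \sum_(i < N)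
      output_prob A (two_point (b i) y1 y0 : mechanism R D n O) x good)%E.
  apply: cvg_nnesum => i _; last exact: cvg_output_prob.
  by apply: nearW => m; exact: integral_hits_ge0.
rewrite -(cvg_lim _ cvg_sum)//; apply: lime_le.
  by apply/cvg_ex; eexists; exact: cvg_sum.
apply: nearW => m; rewrite -ge0_integral_sum//; last first.
  by move=> i w _; rewrite lee_fin hits_ge0.
have mcalls : measurable_fun setT (fun w => (calls m w [tuple])%:E).
  apply/measurable_EFinP; apply: measurable_payoff_coins => *.
  exact: measurable_cst.
apply: (@le_trans _ _ (\int[coins_law A]_w
    ((n%:R + N%:R * p0)%:E * (calls m w [tuple])%:E))%E).
  apply: ge0_le_integral => //.
  - by move=> w _; apply: sume_ge0 => i _; rewrite lee_fin hits_ge0.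
  - exact: emeasurable_sum.
  - exact: measurable_funeM.
  - move=> w _; rewrite sumEFin -EFinM lee_fin.
    by have := sum_hits_le m w [tuple]; rewrite /= mulr0 add0r.
rewrite ge0_integralZl//.
- rewrite EFinM lee_wpmul2l ?lee_fin//; apply: le_trans callsT.
  apply: ereal_sup_ubound; exists m => //.
  by apply: eq_integral => w _; exact: calls_uptoE.
- by move=> w _; rewrite lee_fin payoff_ge0.
Qed.

End hidden_secret.
End output.

(** * Hidden coins and group privacy *)

(** Group privacy: unrolling yields additive errors [a ^+ j * delta] for [j < n], each at most
    [a ^+ n * delta] because [1 <= a]. *)
Lemma geometric_chain (R : realFieldType) (f : nat -> R) (a delta : R) n :
  1 <= a -> 0 <= delta ->
  (forall j, (j < n)%N -> f j <= a * f j.+1 + delta) ->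
  f 0%N <= a ^+ n * (f n + n%:R * delta).
Proof.
move=> a1 d0; elim: n => [|n IH] fS; first by rewrite expr0 mul1r mul0r addr0.
apply: le_trans (IH _) _; first by move=> j jn; apply: fS; exact: ltnW.
rewrite exprSr -mulrA ler_wpM2l ?exprn_ge0 ?(le_trans ler01 a1)//.
have := fS n (ltnSn n); rewrite -(natr1 n).
have : 0 <= n%:R * delta by rewrite mulr_ge0.
nra.
Qed.

Section hidden_coin.
Context (R : realType) (n : nat) (eps : R).

Definition secret_weight (s v : nat) : R := if v == s then expR eps else 1.

(** The product equals e^(eps k), with k the number of entries equal to [s]; as a product over
    entries it changes in one factor only between neighbors. *)
Definition hidden_bias_fun (s : nat) (q : n.-tuple nat) : R :=
  expR (- (eps * n%:R)) / 2 * \prod_(i < n) secret_weight s (tnth q i).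

Hypothesis eps_ge0 : 0 <= eps.

Let exp_eps1 : 1 <= expR eps. Proof. by rewrite -expR0 ler_expR. Qed.

Lemma secret_weight_ge1 s v : 1 <= secret_weight s v.
Proof. by rewrite /secret_weight; case: ifP. Qed.

Lemma hidden_bias_gt0 s q : 0 < hidden_bias_fun s q.
Proof.
rewrite mulr_gt0 ?divr_gt0 ?expR_gt0// prodr_gt0// => i _.
exact: lt_le_trans (secret_weight_ge1 _ _).
Qed.

Lemma hidden_bias_le s q : hidden_bias_fun s q <= 2^-1.
Proof.
rewrite /hidden_bias_fun mulrAC -[leRHS]mul1r ler_wpM2r//.
apply: (@le_trans _ _ (expR (- (eps * n%:R)) * expR (eps * n%:R))); last first.
  by rewrite -expRD addNr expR0.
rewrite ler_wpM2l ?expR_ge0// expRM_natr -[in leRHS](card_ord n).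
rewrite -prodr_const; apply: ler_prod => i _.
rewrite (le_trans ler01 (secret_weight_ge1 _ _))/= /secret_weight.
by case: ifP.
Qed.

Lemma measurable_hidden_bias s : measurable_fun setT (hidden_bias_fun s).
Proof.
apply: measurable_funM => //; apply: measurable_prod => i _.
rewrite (_ : (fun q => _) = secret_weight s \o (fun q : n.-tuple nat => tnth q i))//.
by apply: measurableT_comp => //; exact: measurable_tnth.
Qed.

Lemma hidden_bias_le1 s q : hidden_bias_fun s q <= 1.
Proof. by have := hidden_bias_le s q; lra. Qed.

Definition hidden_bias s : bias R (n.-tuple nat) :=
  Bias (measurable_hidden_bias s) (fun q => ltW (hidden_bias_gt0 s q))
    (hidden_bias_le1 s).

(** Only the factor at the differing entry changes, and it lies between 1 and e^eps. *)
Lemma hidden_bias_neighbor s (q q' : n.-tuple nat) : hamming q q' = 1%N ->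
  hidden_bias s q <= expR eps * hidden_bias s q'.
Proof.
move=> /eqP; rewrite /hamming -cardsE => /cards1P[i /setP qq'].
have same j : j != i -> tnth q j = tnth q' j.
  by move=> /negbTE ji; have := qq' j; rewrite !inE ji => /negbFE/eqP.
rewrite /= /hidden_bias_fun mulrCA ler_wpM2l ?divr_ge0 ?expR_ge0//.
rewrite (bigD1 i)//= [in leRHS](bigD1 i)//=.
rewrite (eq_bigr (fun j => secret_weight s (tnth q' j))); last by move=> j /same ->.
rewrite mulrA ler_wpM2r//.
  by apply: prodr_ge0 => j _; exact: le_trans (secret_weight_ge1 _ _).
apply: (@le_trans _ _ (expR eps)); first by rewrite /secret_weight; case: ifP.
by rewrite ler_peMr ?expR_ge0 ?secret_weight_ge1.
Qed.

Lemma hidden_bias_absent s (q : n.-tuple nat) : s \notin q ->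
  hidden_bias s q = expR (- (eps * n%:R)) / 2.
Proof.
move=> sq; rewrite /= /hidden_bias_fun big1 ?mulr1// => i _.
by rewrite /secret_weight; case: eqP => // E; rewrite -E mem_tnth in sq.
Qed.

Lemma hidden_bias_secret s : hidden_bias s [tuple of nseq n s] = 2^-1.
Proof.
rewrite /= /hidden_bias_fun (eq_bigr (fun=> expR eps)); last first.
  by move=> i _; rewrite /secret_weight tnth_nseq eqxx.
rewrite prodr_const card_ord -expRM_natr mulrC mulrA.
by rewrite -expRD subrr expR0 mul1r.
Qed.

End hidden_coin.

(** * Privacy of two-point mechanisms *)

Section dp_two_point.
Context (R : realType) (dD : measure_display) (D : measurableType dD) (n : nat).
Context (dY : measure_display) (Y : measurableType dY).
Variables (b : bias R (n.-tuple D)) (y1 y0 : Y) (eps : R).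

(** This is why biases stay below 1/2: t (1 - t) increases on [0, 1/2], so for p < q one has p (1 -
    p) <= q (1 - q) <= e p (1 - q), and p cancels. For q <= p it is immediate from 1 <= e. *)
Lemma complement_bias_le (e p q : R) : 0 < p -> p <= 2^-1 -> q <= 2^-1 ->
  1 <= e -> q <= e * p -> 1 - p <= e * (1 - q).
Proof.
move=> p0 p2 q2 e1 qep; have [qp|pq] := leP q p; first nra.
rewrite -(ler_pM2l p0); nra.
Qed.

Lemma dp_two_point : 0 <= eps -> (forall q, 0 < b q) -> (forall q, b q <= 2^-1) ->
  (forall q q', hamming q q' = 1%N -> b q <= expR eps * b q') ->
  dp eps 0 (two_point b y1 y0).
Proof.
move=> eps0 b0 b2 bnb q q' qq' S mS.
rewrite !two_pointE -EFinM adde0 lee_fin mulrDr !mulrA lerD// ler_wpM2r//.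
  exact: bnb.
apply: complement_bias_le => //; first by rewrite -expR0 ler_expR.
by apply: bnb; rewrite -qq'; apply: eq_card => i; rewrite !inE eq_sym.
Qed.

End dp_two_point.

Section hybrids.
Context (n : nat) (s : nat).

(** Interpolates between the all-zero dataset and the one filled with [s], one entry at a time, as
    group privacy requires. *)
Definition hybrid (j : nat) : n.-tuple nat :=
  [tuple if (i < j)%N then s else 0%N | i < n].

Lemma hamming_hybrid j : s != 0%N -> (j < n)%N ->
  hamming (hybrid j) (hybrid j.+1) = 1%N.
Proof.
move=> s0 jn; apply: eq_trans (card1 (Ordinal jn)); apply: eq_card => i.
rewrite !inE !tnth_mktuple ltnS -val_eqE /=.
by case: ltngtP; rewrite ?eqxx// eq_sym.
Qed.

Lemma hybrid0 : hybrid 0 = [tuple of nseq n 0%N].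
Proof. by apply: eq_from_tnth => i; rewrite tnth_mktuple tnth_nseq. Qed.

Lemma hybridn : hybrid n = [tuple of nseq n s].
Proof. by apply: eq_from_tnth => i; rewrite tnth_mktuple tnth_nseq ltn_ord. Qed.

End hybrids.

(** * Scores and their median *)

Section scores.
Context (R : realType).
Local Notation scored := (unit * measurableTypeR R)%type.

Definition pass : scored := (tt, 1).
Definition fail : scored := (tt, 0).
Definition at_least (z : R) : set scored := [set y | z <= y.2].

Lemma measurable_at_least z : measurable (at_least z).
Proof.
rewrite (_ : at_least z = snd @^-1` `[z, +oo[%classic); last first.
  by apply/seteqP; split => y; rewrite /at_least/= in_itv/= andbT.
rewrite -[X in measurable X]setTI.
by apply: measurable_snd.
Qed.

(** At bias exactly 1/2 a score of at least z has probability at least 1/2 precisely when z <= 1, so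
    the supremum is the passing score. *)
Lemma median_val_two_point dX (X : measurableType dX) (b : bias R X) q :
  b q = 2^-1 -> median_val (two_point b pass fail q) = 1.
Proof.
move=> bq; rewrite /median_val.
have E (z : R) : two_point b pass fail q [set y | z <= y.2] =
   (2^-1 * (z <= 1)%R%:R + 2^-1 * (z <= 0)%R%:R)%:E.
  have half : 1 - 2^-1 = 2^-1 :> R by lra.
  rewrite two_pointE bq half !indicE; congr (_ * _%:R + _ * _%:R)%:E.
  - by congr nat_of_bool; apply/idP/idP; rewrite inE.
  - by congr nat_of_bool; apply/idP/idP; rewrite inE.
apply/eqP; rewrite eq_le; apply/andP; split.
  apply: ge_sup; first by exists 1; rewrite /= E lee_fin lexx ler10 mulr0 addr0 mulr1.
  move=> z /=; rewrite E lee_fin; case: (leP z 1) => // z1.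
  have -> : (z <= 0) = false by apply/negbTE; rewrite -ltNge (lt_trans _ z1).
  by rewrite !mulr0 addr0 leNgt invr_gt0 ltr0n.
apply: ub_le_sup; last by rewrite /= E lee_fin lexx ler10 mulr0 addr0 mulr1.
exists 1 => z /=; rewrite E lee_fin; case: (leP z 1) => // z1.
have -> : (z <= 0) = false by apply/negbTE; rewrite -ltNge (lt_trans _ z1).
by rewrite !mulr0 addr0 leNgt invr_gt0 ltr0n.
Qed.

End scores.

(** * Two-sided bound on the probability of failure *)

Section failure_bound.
Context (R : realType) (n N : nat) (A : oracle_algorithm R nat n unit).
Variables (eps c delta gamma T : R).
Hypotheses (eps_ge0 : 0 <= eps) (c_ge0 : 0 <= c) (delta_ge0 : 0 <= delta).
Hypothesis N_gt0 : (0 < N)%N.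

Let coin (b : bias R (n.-tuple nat)) : mechanism R nat n unit :=
  two_point b (pass R) (fail R).

Hypothesis A_spec : forall b, dp eps 0 (fun x => coin b x) ->
  [/\ dp (c * eps) delta (output_prob A (coin b)),
      forall x, ((1 - gamma)%:E <= output_prob A (coin b) x
                  [set y | (median_val (coin b x) <= y.2)%R])%E &
      forall x, (expected_calls A (coin b) x <= T%:E)%E].

Let p0 : R := expR (- (eps * n%:R)) / 2.

Let p0_gt0 : 0 < p0. Proof. by rewrite divr_gt0 ?expR_gt0. Qed.

Let p0_le : p0 <= 2^-1.
Proof.
by rewrite /p0 -[leRHS]mul1r ler_wpM2r// expR_le1 oppr_le0 mulr_ge0.
Qed.

Let p0_le1 : p0 <= 1. Proof. by have := p0_le; lra. Qed.

(** The reference coin, with which every hidden coin agrees on datasets missing its secret. *)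
Let constant_bias : bias R (n.-tuple nat) :=
  Bias (measurable_cst p0) (fun=> ltW p0_gt0) (fun=> p0_le1).

Let exp_eps_ge1 : 1 <= expR eps. Proof. by rewrite -expR0 ler_expR. Qed.

Let good : set (unit * measurableTypeR R) := at_least 1.
Let mgood : measurable good. Proof. exact: measurable_at_least. Qed.
Let mbad : measurable (~` good). Proof. exact: measurableC. Qed.

Let start : n.-tuple nat := [tuple of nseq n 0%N].
Let prob b x (S : set (unit * measurableTypeR R)) : R :=
  fine (output_prob A (coin b) x S).

Let probK b x S : measurable S -> (prob b x S)%:E = output_prob A (coin b) x S.
Proof. by move=> mS; rewrite fineK ?output_prob_fin_num. Qed.

(** The shift to [i.+1] keeps secrets nonzero, so that successive hybrids starting from zeros do
    differ. *)
Let hidden (i : 'I_N) := hidden_bias n eps_ge0 i.+1.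

Lemma dp_hidden i : dp eps 0 (fun x => coin (hidden i) x).
Proof.
apply: dp_two_point => //.
- by move=> q; exact: hidden_bias_gt0.
- by move=> q; exact: hidden_bias_le.
- by move=> q q'; exact: hidden_bias_neighbor.
Qed.

(** Averaging: the success probabilities of the [N] secrets sum to at most [(n + N * p0) * T], so
    one of them is at most the mean. *)
Lemma exists_well_hidden :
  exists i, prob (hidden i) start good <= (n%:R / N%:R + p0) * T.
Proof.
have [_ _ calls_le] : [/\ dp (c * eps) delta (output_prob A (coin constant_bias)),
    forall x, ((1 - gamma)%:E <= output_prob A (coin constant_bias) x
      [set y | (median_val (coin constant_bias x) <= y.2)%R])%E &
    forall x, (expected_calls A (coin constant_bias) x <= T%:E)%E].
  apply: A_spec; apply: dp_two_point => //= q q' _.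
  by rewrite ler_peMl// ltW.
have := @sum_output_prob_le R _ nat n _ unit A start (pass R) (fail R) N
  (fun i => i.+1 : nat) hidden constant_bias p0 good.
have succ_inj : injective (fun i : 'I_N => i.+1) by move=> i j [] /val_inj.
move=> /(_ succ_inj (fun=> erefl)) /(_ (fun i q => hidden_bias_absent eps_ge0 (q := q))).
move=> /(_ mgood _ T (calls_le _)); rewrite /good /at_least /= ler10 => /(_ notF).
rewrite -/good => sum_le; apply: contrapT => /forallNP all_gt.
have : \sum_(i < N) prob (hidden i) start good <= (n%:R + N%:R * p0) * T.
  rewrite -lee_fin -sumEFin; apply: le_trans sum_le.
  by apply: lee_sum => i _; rewrite probK.
apply/negP; rewrite -ltNge.
have -> : (n%:R + N%:R * p0) * T = \sum_(i < N) ((n%:R / N%:R + p0) * T).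
  rewrite sumr_const card_ord -[RHS]mulr_natl mulrA mulrDr [N%:R * (_ / _)]mulrC divfK//.
  by rewrite pnatr_eq0 -lt0n.
apply: ltr_sum; first by apply/hasP; exists (Ordinal N_gt0); rewrite ?mem_index_enum.
by move=> i _; rewrite ltNge; apply/negP; exact: all_gt.
Qed.

(** For a well-hidden secret, both sides estimate the probability of a score below 1 at [start]:
    from below since success is rare there, from above by group privacy. *)
Lemma failure_bound : 1 - gamma - (n%:R / N%:R + p0) * T <=
  expR (c * eps) ^+ n * (gamma + n%:R * delta).
Proof.
have [i good_le] := exists_well_hidden.
have [dpA util _] := A_spec (dp_hidden i).
have mass x : prob (hidden i) x good + prob (hidden i) x (~` good) <= 1.
  by rewrite -lee_fin EFinD !probK// output_prob_setC_le1.
(* On the dataset filled with the secret the median is 1, so utility forces [good] up to [gamma]. *)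
have fail_end : prob (hidden i) (hybrid n i.+1 n) (~` good) <= gamma.
  have := util (hybrid n i.+1 n).
  rewrite median_val_two_point; last by rewrite hybridn hidden_bias_secret.
  rewrite -probK// lee_fin => good_ge.
  by have := mass (hybrid n i.+1 n); move: good_ge; rewrite -/good; lra.
(* Runs that never halt have no output, so the masses of [good] and its complement are not known to
   sum to 1; utility at [start], whatever the median there, makes the sum at least [1 - gamma]. *)
have fail_start : 1 - gamma - prob (hidden i) start good <=
    prob (hidden i) start (~` good).
  rewrite lerBlDl -lee_fin [leRHS]EFinD !probK//; apply: le_trans (util start) _.
  by apply: output_prob_le_setC => //; exact: measurable_at_least.
apply: (@le_trans _ _ (prob (hidden i) start (~` good))).
  by apply: le_trans fail_start; rewrite lerD2l lerN2.
rewrite (_ : start = hybrid n i.+1 0); last by rewrite hybrid0.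
have cexp : 1 <= expR (c * eps) by rewrite -expR0 ler_expR mulr_ge0.
apply: le_trans (geometric_chain (n := n)
  (f := fun j => prob (hidden i) (hybrid n i.+1 j) (~` good)) cexp delta_ge0 _) _.
  move=> j jn; rewrite -lee_fin EFinD EFinM !probK//.
  by apply: dpA => //; exact: hamming_hybrid.
by rewrite ler_wpM2l ?lerD2r// exprn_ge0// expR_ge0.
Qed.

End failure_bound.

(** * Choice of [n] and [N], and the final contradiction *)

Theorem mainTheorem1 (R : realType) (eps c delta gamma T : R)
    (A : forall (dD : measure_display) (D : measurableType dD) (n : nat)
           (dO : measure_display) (O : measurableType dO),
         oracle_algorithm R D n O)
    (eps_gt0 : 0 < eps) (c_gt0 : 0 < c) (delta_ge0 : 0 <= delta)
    (gamma_gt0 : 0 < gamma) (gamma_lt1 : gamma < 1) (T_ge : expR eps <= T)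
    (A_spec : forall (dD : measure_display) (D : measurableType dD) (n : nat)
         (dO : measure_display) (O : measurableType dO)
         (M : mechanism R D n O),
       (1 <= n)%N ->
       dp eps 0 (fun x => M x) ->
       [/\ dp (c * eps) delta (output_prob (A dD D n dO O) M),
           forall x : n.-tuple D,
             ((1 - gamma)%:E <=
              output_prob (A dD D n dO O) M x
                [set y | (median_val (M x) <= y.2)%R])%E &
           forall x : n.-tuple D,
             (expected_calls (A dD D n dO O) M x <= T%:E)%E])
    (eps_le3 : eps <= 3)
    (delta_lt : delta < eps * gamma / (40 * ln (8 * T))) :
  8^-1 * (8 * gamma) `^ (- (40 * c)^-1) <= T /\
  ln ((8 * gamma)^-1) / (40 * ln (8 * T)) <= c.
Proof.
have T_gt1 : 1 < T by apply: lt_le_trans T_ge; rewrite expR_gt1.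
have T_gt0 : 0 < T by exact: lt_trans T_gt1.
have T8_gt0 : 0 < 8 * T by rewrite mulr_gt0.
have g8_gt0 : 0 < 8 * gamma by rewrite mulr_gt0.
have lnT8_gt0 : 0 < ln (8 * T) by apply: ln_gt0; lra.
(* Taking logarithms turns the bound on [T] into the bound on [c]. *)
suff bound : ln ((8 * gamma)^-1) / (40 * ln (8 * T)) <= c.
  split => //; rewrite mulrC ler_pdivrMr// [leRHS]mulrC.
  rewrite -ler_ln ?posrE ?powR_gt0// ln_powR mulNr -mulrN -lnV ?posrE//.
  rewrite ler_pdivrMl ?mulr_gt0// [leRHS]mulrAC [leRHS]mulrC.
  by move: bound; rewrite ler_pdivrMr ?mulr_gt0.
rewrite leNgt; apply/negP => c_lt.
rewrite ltr_pdivlMr ?mulr_gt0// in c_lt.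
set L := ln ((8 * gamma)^-1) in c_lt.
set l := ln (8 * T) in lnT8_gt0 delta_lt c_lt.
have L_gt0 : 0 < L by apply: lt_trans c_lt; rewrite !mulr_gt0.
have gL : (8 * gamma) * expR L = 1.
  by rewrite /L lnK ?posrE ?invr_gt0// mulfV// gt_eqF.
(* [n] is least with [eps n > ln (4 T)]; as [eps <= ln T], also
   [eps n <= 2 ln (8 T)]. *)
pose n := (Num.truncn (ln (4 * T) / eps)).+1.
have ln4T_ge0 : 0 <= ln (4 * T) by apply: ln_ge0; lra.
have /andP[n_lb n_ub] := truncn_itv (divr_ge0 ln4T_ge0 (ltW eps_gt0)).
rewrite -/n in n_ub.
have en_gt : ln (4 * T) < eps * n%:R by rewrite [ltRHS]mulrC -ltr_pdivrMr.
have en_le : eps * n%:R <= 2 * l.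
  have eps_le : eps <= ln T by rewrite -ler_expR lnK.
  have lT : ln T <= l by rewrite ler_ln ?posrE// ler_peMl// ?ltW//; lra.
  have l4T : ln (4 * T) <= l by rewrite ler_ln ?posrE ?mulr_gt0//; lra.
  rewrite ler_pdivlMr// mulrC in n_lb; rewrite /n -natr1 mulrDr mulr1; lra.
(* The choice of [n] gives e^(- eps n) <= 1 / (4 T). *)
have p0T : expR (- (eps * n%:R)) / 2 * T <= 8^-1.
  have : expR (- (eps * n%:R)) * (4 * T) <= 1.
    rewrite -[4 * T]lnK ?posrE ?mulr_gt0// -expRD -[leRHS]expR0 ler_expR; lra.
  lra.
(* Enough candidates for the two parts of the success bound to total at most 1/4. *)
pose N := (Num.truncn (8 * n%:R * T)).+1.
have N_gt : 8 * n%:R * T < N%:R by rewrite /N truncnS_gt.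
have nNT : n%:R / N%:R * T <= 8^-1.
  by rewrite mulrAC ler_pdivrMr ?ltr0n// ; lra.
have := @failure_bound R n N (A _ nat n _ unit) eps c delta gamma T
  (ltW eps_gt0) (ltW c_gt0) delta_ge0 isT
  (fun b => A_spec _ nat n _ unit (two_point b (pass R) (fail R)) isT).
apply/negP; rewrite -ltNge.
(* Indeed c eps n <= 2 c l <= 40 c l < L. *)
have expL : expR (c * eps) ^+ n <= expR L.
  rewrite -expRM_natr ler_expR -mulrA; apply: le_trans (ltW c_lt).
  by rewrite ler_wpM2l ?(ltW c_gt0)//; lra.
(* From delta < eps gamma / (40 l) and eps n <= 2 l. *)
have ndelta : n%:R * delta <= gamma / 20.
  have n0 : 0 < n%:R :> R by rewrite ltr0n.
  rewrite ltr_pdivlMr ?mulr_gt0// in delta_lt.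
  have := ltW delta_lt; rewrite -(ler_pM2l n0) => nd.
  have nl : n%:R * (eps * gamma) <= 2 * l * gamma.
    by rewrite mulrA [n%:R * eps]mulrC ler_wpM2r// ltW.
  by rewrite -(ler_pM2r lnT8_gt0); lra.
have : expR (c * eps) ^+ n * (gamma + n%:R * delta) <= expR L * (gamma + gamma / 20).
  apply: ler_pM; rewrite ?exprn_ge0 ?expR_ge0 ?lerD2l//.
  by rewrite addr_ge0 ?mulr_ge0// ltW.
have gamma_le : 8 * gamma < 1.
  have : 8 * gamma * 1 < 8 * gamma * expR L by rewrite ltr_pM2l// expR_gt1.
  by rewrite gL mulr1.
(* As e^L = 1 / (8 gamma), the upper bound is 21/160, whereas gamma < 1/8 puts the lower bound above
   1 - 1/8 - 1/4 = 5/8. *)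
have -> : expR L * (gamma + gamma / 20) = 8 * gamma * expR L * (21 / 160) by field.
rewrite gL mulrDl => /le_lt_trans; apply; lra.
Qed.
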